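(* Let $\kappa$ be an uncountable cardinal, let $pt\in\{0,1\}$, and let $\overrightarrow{pt}\in\{0,1\}^{\kappa}$ be the point all of whose coordinates are equal to $pt$. Then the space $X=\{0,1\}^{\kappa}\setminus\{\overrightarrow{pt}\}$ is Tychonoff, discretely star-Lindelöf, pseudocompact, and has extent $e(X)=\kappa$.
   Context: $\{0,1\}$ is the two-point discrete space, $\{0,1\}^{\kappa}$ carries the product topology, and $X$ the subspace topology. Tychonoff means $T_{3\frac12}$. Pseudocompact means that every continuous real-valued function on the space is bounded. The extent $e(X)$ is the supremum of the cardinalities of closed discrete subspaces of $X$. For a family $\mathcal{U}$ of subsets of $X$ and $F\subset X$, put $\mathrm{St}(F,\mathcal{U}):=\bigcup\{U\in\mathcal{U}: U\cap F\neq\emptyset\}$. A space $X$ is discretely star-Lindelöf if for every open cover $\mathcal{U}$ of $X$ there exists a countable set $F\subset X$ which is closed in $X$ and discrete such that $\mathrm{St}(F,\mathcal{U})=X$. *)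

(* Defs.v *)
From mathcomp Require Import all_boot all_order all_algebra.
From mathcomp Require Import all_classical all_reals all_analysis.
Import numFieldNormedType.Exports.

Set Implicit Arguments.
Unset Strict Implicit.
Unset Printing Implicit Defensive.

Local Open Scope classical_set_scope.
Local Open Scope card_scope.

(** The library phrases [completely_regular_space] with a uniformity coarser than
    the topology; this is its usual form with continuous functions. *)
Lemma completely_regular_spaceP (R : realType) (T : topologicalType) :
  completely_regular_space T <->
  forall (x : T) (B : set T), closed B -> ~ B x ->
    exists f : T -> R, [/\ continuous f, range f `<=` `[0%R, 1%R]%classic,
      f x = 0%R & forall y, B y -> f y = 1%R].
Proof.
split=> h x B cB nBx.
  have /(@uniform_separatorP _ R)[f [cf rf f0 f1]] := h x B cB nBx.
  exists f; split=> //; first by apply: f0; exists x.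
  by move=> y By; apply: f1; exists y.
apply/(@uniform_separatorP _ R); have [f [cf rf f0 f1]] := h x B cB nBx.
exists f; split=> // _ [y By <-] /=; last exact: f1.
by rewrite By.
Qed.

(** T_{3 1/2}. *)
Definition tychonoff_space (T : topologicalType) : Prop :=
  accessible_space T /\ completely_regular_space T.

Definition pseudocompact_space (R : realType) (T : topologicalType) : Prop :=
  forall f : T -> R, continuous f -> bounded_fun f.

(** [set_type D] carries the subspace topology (initial for the inclusion),
    whereas every point outside [D] is isolated in [subspace D]. *)
Definition discrete_subset (T : topologicalType) (D : set T) : Prop :=
  forall A : set (set_type D), open A.

Definition closed_discrete (T : topologicalType) (D : set T) : Prop :=
  closed D /\ discrete_subset D.

(** e(T) = |K|: the cardinal |K| is the least upper bound of the cardinals of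
    the closed discrete subspaces of [T].  Cardinals are represented by sets
    compared through injections, so e(T) is determined up to [#=]. *)
Definition has_extent (T : topologicalType) (I : Type) (K : set I) : Prop :=
  (forall D : set T, closed_discrete D -> D #<= K) /\
  (forall (J : Type) (L : set J),
     (forall D : set T, closed_discrete D -> D #<= L) -> K #<= L).

Definition open_cover (T : topologicalType) (U : set (set T)) : Prop :=
  (forall V, U V -> open V) /\ \bigcup_(V in U) V = [set: T].

Definition star (T : Type) (F : set T) (U : set (set T)) : set T :=
  \bigcup_(V in [set V | U V /\ V `&` F !=set0]) V.

(** [countable] includes the finite sets. *)
Definition discretely_star_Lindelof (T : topologicalType) : Prop :=
  forall U : set (set T), open_cover U ->
    exists F : set T, [/\ countable F, closed_discrete F & star F U = [set: T]].

(** [{ptws K -> bool}] is [K -> bool] with the product topology, [bool] being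
    discrete. *)
Definition punctured_cube (K : Type) (pt : bool) : set {ptws K -> bool} :=
  ~` [set (fun=> pt)].

Arguments punctured_cube : clear implicits.

(* Main.v *)
Require Import Defs.
From mathcomp Require Import all_boot all_order all_algebra finmap.
From mathcomp Require Import all_classical all_reals all_analysis.
Import Order.TTheory GRing.Theory Num.Theory numFieldNormedType.Exports.

Set Implicit Arguments.
Unset Strict Implicit.
Unset Printing Implicit Defensive.

Local Open Scope classical_set_scope.
Local Open Scope card_scope.

(** Write [C_i] for the compact set of the points [x] of [X] with [x i <> pt].
    A subset [D] of [X] is closed and discrete iff every [D `&` C_i] is finite.
    Hence [D] maps finite-to-one to [K], which bounds the extent by [K], and the
    points with a single coordinate different from [pt] attain the bound.

    Given an open cover, compactness of [C_a] yields a finite set [S a] of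
    coordinates, containing [a], such that points of [C_a] that agree on [S a]
    lie in a common member of the cover.  The combinatorial core
    ([finite_trace]) then produces countably many points [f_n], with finitely
    many of them in each [C_b], such that every [x] in [X] agrees with some [f_n]
    on [S a] for some [a] with [x a <> pt].

    For pseudocompactness, an unbounded continuous function is already unbounded
    on a sequence of points that differ from the opposite constant point
    at finitely many coordinates only.  All of them lie in the set of points that
    are equal to [~~ pt] off a fixed countable set of coordinates; it is compact
    and, [K] being uncountable, it avoids the removed point. *)

From mathcomp Require Import finmap.

(** * Cardinal arithmetic: absorbing a countable factor *)

Lemma infinite_setX_nat (K : Type) :
  infinite_set [set: K] -> [set: K * nat] #<= [set: K].
Proof.
elim/Ppointed: K => [K|K] infK.
  by case: infK; rewrite emptyE; exact: finite_set0.
pose P (A : set (nat -> K)) :=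
  forall s t m n, A s -> A t -> s m = t n -> s = t /\ m = n.
have [A [PA Amax]] : exists A, P A /\ forall B, A `<` B -> ~ P B.
  apply: Zorn_bigcup => F FP totF s t m n [B FB Bs] [C FC Ct].
  by have [BC|CB] := totF B C FB FC;
    [apply: (FP C) => //; exact: BC | apply: (FP B) => //; exact: CB].
(* A maximal family of injective sequences with disjoint ranges covers [K] up to
   the finite set [L]. *)
pose L := [set x | forall s n, A s -> s n <> x].
have finL : finite_set L.
  apply: contrapT => /infiniteP/pcard_leP[s].
  have sL n : L (s n) by exact: (@funS _ _ _ _ s).
  apply: (Amax (A `|` [set s : nat -> K])).
    split=> [t At|sub]; first by left.
    by apply: (sL 0 s 0) => //; apply: sub; right.
  move=> t u m n [At|->] [Au|->] //.
  - exact: PA.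
  - by move=> /(sL n t m At).
  - by move=> /esym /(sL m u n Au).
  - by move=> smn; split=> //; apply: (@inj _ _ _ s) smn; exact: in_setT.
have [e einj] := countable_injP _ (finite_set_countable finL).
have [s0 As0] : exists s, A s.
  apply: contrapT => nA; apply: infK; apply: sub_finite_set finL => x _ s n As.
  by case: nA; exists s.
(* Each [x] gets an address: its place [inl i] in a sequence of [A], or, for a leftover point of
   [L], its number [inr k] along the arbitrary sequence [s0]. The pair [(x, m)] then goes to the
   term of that same sequence whose index codes the tag together with [m]. *)
have /choice[q qP] : forall x, exists q : (nat -> K) * (nat + nat),
    A q.1 /\ match q.2 with
             | inl i => q.1 i = x
             | inr k => L x /\ e x = k
             end.
  move=> x; have [Lx|] := pselect (L x); first by exists (s0, inr (e x)).
  move=> /existsNP[s /existsNP[n /not_implyP[As /contrapT snx]]].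
  by exists (s, inl n).
apply/pcard_injP.
exists (fun p => (q p.1).1 (choice.pickle ((q p.1).2, p.2))).
move=> [x m] [y n] _ _ /=.
have [Ax xP] := qP x; have [Ay yP] := qP y.
move=> /(PA _ _ _ _ Ax Ay)[q1 /(pcan_inj choice.pickleK)[q2 ->]].
congr (_, _); move: xP yP; rewrite q1 q2; case: (q y).2 => [i -> //|k].
by move=> [Lx ex] [Ly ey]; exact: einj (mem_set Lx) (mem_set Ly) (etrans ex (esym ey)).
Qed.

Lemma card_le_countable_fibers (T K : Type) (D : set T) (g : T -> K) :
  infinite_set [set: K] -> (forall k, countable (D `&` g @^-1` [set k])) ->
  D #<= [set: K].
Proof.
move=> infK cD; apply: card_le_trans (infinite_setX_nat infK).
elim/Ppointed: K => [K|K] in g infK cD *.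
  by case: infK; rewrite emptyE; exact: finite_set0.
have /choice[e eP] := fun k => countable_injP _ (cD k).
apply/pcard_injP; exists (fun x => (g x, e (g x) x)) => x y.
move=> /set_mem Dx /set_mem Dy [gxy exy].
by apply: (eP (g x)); [exact: mem_set|exact: mem_set|rewrite {2}gxy].
Qed.

(** * Combinatorics of finite traces *)

Lemma finite_powerset (T : Type) (B : set T) :
  finite_set B -> finite_set [set A | A `<=` B].
Proof.
elim/Pchoice: T => T in B *.
move=> /finite_fsetP[X ->].
apply: (@sub_finite_set _ _
  ((fun Y : {fset T} => [set` Y]) @` [set` fpowerset X]%fset)).
  move=> A /= AX.
  have finA : finite_set A by exact: sub_finite_set AX (finite_fset X).
  exists (fset_set A); last by rewrite fset_setK.
  rewrite /= fpowersetE; apply/fsubsetP => x; rewrite in_fset_set//.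
  by move=> /set_mem /AX.
by apply: finite_image; exact: finite_fset.
Qed.

(** Supplies the countable layers from which [finite_trace] is assembled. *)
Lemma closure_under_finite_map (K : Type) (S : K -> set K) (a0 : K) :
  (forall a, finite_set (S a)) ->
  exists Z : set K, [/\ countable Z, Z a0 & forall a, Z a -> S a `<=` Z].
Proof.
move=> finS; pose step Z := \bigcup_(a in Z) S a.
exists (\bigcup_n iter n step [set a0]); split; last 2 first.
- by exists 0.
- by move=> a [n _ Za] b Sab; exists n.+1 => //; exists a.
apply: bigcup_countable => // n _; elim: n => [|n IHn] /=.
  exact/finite_set_countable/finite_set1.
by apply: bigcup_countable => // a _; exact: finite_set_countable.
Qed.

(** In the application [x] is the set of coordinates where a point differs from [pt], and [c b]
    lists the indices [n] such that [f_n] differs from [pt] at [b]. An index pairs the code of a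
    finite pattern with a number that keeps it fresh. *)
Lemma finite_trace (K : Type) (S : K -> set K) :
  (forall a, finite_set (S a)) -> (forall a, S a a) ->
  exists2 c : K -> set (nat * nat), (forall a, finite_set (c a)) &
    forall x : set K, x !=set0 -> exists2 a, x a &
      exists n, forall b, S a b -> (c b n <-> x b).
Proof.
move=> finS reflS.
pose dom (G : set (K * set (nat * nat))) a := exists C, G (a, C).
pose P G := [/\ forall a C C', G (a, C) -> G (a, C') -> C = C',
  forall a C, G (a, C) -> finite_set C,
  forall a, dom G a -> S a `<=` dom G &
  forall x : set K, x `&` dom G !=set0 -> exists2 a, x a & dom G a /\
    exists n, forall b C, S a b -> G (b, C) -> (C n <-> x b)].
(* [G] is the graph of a partial function, defined on a set [dom G] closed under
   [S] and having the required property for all [x] that meet [dom G]. *)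
have [G [[Gfun Gfin Gclosed Gtrace] Gmax]] :
    exists G, P G /\ forall G', G `<` G' -> ~ P G'.
  apply: Zorn_bigcup => F FP totF.
  have Ufun a C C' : (\bigcup_(X in F) X) (a, C) ->
      (\bigcup_(X in F) X) (a, C') -> C = C'.
    move=> [X FX XC] [Y FY YC'].
    have [XY|YX] := totF X Y FX FY.
      by have [Yfun _ _ _] := FP _ FY; exact: Yfun (XY _ XC) YC'.
    by have [Xfun _ _ _] := FP _ FX; exact: Xfun XC (YX _ YC').
  split=> //.
  - by move=> a C [X FX]; have [_ + _ _] := FP _ FX; apply.
  - move=> a [C [X FX XC]] b Sab.
    have [_ _ Xclosed _] := FP _ FX.
    by have [C' XC'] := Xclosed a (ex_intro _ C XC) b Sab; exists C', X.
  - move=> x [a [xa [C [X FX XC]]]].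
    have [_ _ Xclosed Xtrace] := FP _ FX.
    have [|a' xa' [domXa' [n nP]]] := Xtrace x; first by exists a; split=> //; exists C.
    exists a' => //; split; first by case: domXa' => C' ?; exists C', X.
    exists n => b C' Sa'b UC'; apply: nP => //.
    have [C'' XC''] := Xclosed a' domXa' b Sa'b.
    by rewrite (Ufun b C' C'')//; exists X.
suff domG a : dom G a.
  have /choice[c cP] := domG; exists c => [a|x [a xa]]; first exact: Gfin (cP a).
  have [|a' xa' [_ [n nP]]] := Gtrace x; first by exists a.
  by exists a' => //; exists n => b Sab; exact: nP.
apply: contrapT => nGa.
have [Z [cZ Za Zclosed]] := closure_under_finite_map a finS.
(* A maximal [G] is extended to a countable layer [L].  An [x] that avoids
   [dom G] is handled by its [e]-least element [a] in [L]: on [S a] it is given by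
   the pattern [A := x `&` S a], which receives a new index [(code A, m a)] that
   does not occur over [S a `&` dom G].  Each [b] is in finitely many patterns,
   since [e a <= e b] when [A b]. *)
pose L := Z `\` dom G.
have cL : countable L by apply: sub_countable cZ; exact: card_le_setD.
have [e einj] := countable_injP _ cL.
have [code codeinj] := countable_injP _ (countable_finite_subset cL).
(* Over the finite set [S a] the graph [G] uses only finitely many second components, so some number
   avoids them all. *)
have /choice[m mP] : forall a, exists m, forall b C k,
    S a b -> G (b, C) -> ~ C (k, m).
  move=> b; pose M := \bigcup_(b' in S b)
    [set m | exists k C, G (b', C) /\ C (k, m)].
  have finM : finite_set M.
    apply: bigcup_finite => // b' _.
    have [[C GC]|nG] := pselect (dom G b').
      apply: sub_finite_set (finite_image snd (Gfin _ _ GC)) => m [k [C' [GC' C'm]]].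
      by exists (k, m) => //; rewrite (Gfun _ _ _ GC GC').
    by apply: sub_finite_set (finite_set0 _) => m [k [C [GC _]]]; apply: nG; exists C.
  apply: contrapT => /forallNP nm; apply: infinite_nat.
  apply: sub_finite_set finM => m _; apply: contrapT => nMm; apply: (nm m).
  by move=> b' C k Sb GC Cm; apply: nMm; exists b' => //; exists k, C.
pose pat a A := [/\ L a, A a, A `<=` S a `&` L & forall b, A b -> e a <= e b].
have patfin a' A : pat a' A -> A `<=` L /\ finite_set A.
  move=> [_ _ AS _]; split=> [b /AS[]//|].
  by apply: sub_finite_set (finS a') => b /AS[].
pose c b := [set n | exists a A, [/\ pat a A, A b & n = (code A, m a)]].
(* The code alone determines the pattern, so distinct patterns may share a value of [m]. *)
have cE a' A b : pat a' A -> (c b (code A, m a') <-> A b).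
  move=> patA; split=> [[a'' [A' [patA' A'b [codeA _]]]]|Ab]; last by exists a', A.
  by rewrite (codeinj A A' (mem_set (patfin _ _ patA)) (mem_set (patfin _ _ patA'))).
have Lfin b : finite_set [set a | L a /\ e a <= e b].
  apply: (card_le_finite _ (finite_II (e b).+1)).
  apply/pcard_leP/injfunPex; exists e => [a' [_] //|a' b'].
  by move=> /set_mem[La' _] /set_mem[Lb' _]; apply: einj; exact: mem_set.
have cfin b : L b -> finite_set (c b).
  move=> Lb; pose D := \bigcup_(a in [set a | L a /\ e a <= e b])
    ((fun A => (code A, m a)) @` [set A | A `<=` S a]).
  apply: (@sub_finite_set _ _ D).
    move=> _ [a' [A [[La' Aa' AS mina'] Ab ->]]].
    exists a'; first by split=> //; exact: mina'.
    by exists A => // b' /AS[].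
  apply: bigcup_finite => // a' _; apply: finite_image; exact: finite_powerset.
pose G' := G `|` [set p | L p.1 /\ p.2 = c p.1].
have domG' b : dom G' b <-> dom G b \/ L b.
  split=> [[C [GC|[Lb _]]]|[[C GC]|Lb]].
  - by left; exists C.
  - by right.
  - by exists C; left.
  - by exists (c b); right.
have LnG b : L b -> ~ dom G b by case.
have La : L a by [].
apply: (Gmax G').
  split=> [p Gp|sub]; first by left.
  by case: (La) => _; apply; exists (c a); apply: sub; right.
split.
- move=> b C C' [GC|[/= Lb ->]] [GC'|[/= Lb' ->]] //.
  + exact: Gfun GC GC'.
  + by case: Lb' => _ []; exists C.
  + by case: Lb => _ []; exists C'.
- by move=> b C [|[/= Lb ->]]; [exact: Gfin|exact: cfin].
- move=> b /domG'[Gb|[Zb nGb]] b' Sbb'; apply/domG'.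
    by left; exact: Gclosed Gb _ Sbb'.
  by have [|] := pselect (dom G b'); [left|right; split=> //; exact: Zclosed Sbb'].
move=> x [a1 [xa1 /domG' Da1]].
(* If [x] meets [dom G], the old index still works: [dom G] is closed under [S], so the new layer is
   not seen from [S a']. *)
have [xG|nxG] := pselect (x `&` dom G !=set0).
  have [a' xa' [Ga' [n nP]]] := Gtrace x xG.
  exists a' => //; split; first by apply/domG'; left.
  exists n => b C Sab [|[/= [_ []]]]; first exact: nP.
  exact: Gclosed Sab.
have {Da1} La1 : L a1 by case: Da1 => // Ga1; case: nxG; exists a1.
have [a' [La' xa' mina']] : exists a', [/\ L a', x a' &
    forall b, L b -> x b -> e a' <= e b].
  have ex1 : exists n, `[< exists b, [/\ L b, x b & e b = n] >].
    by exists (e a1); apply/asboolP; exists a1.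
  case: (ex_minnP ex1) => n /asboolP[b [Lb xb <-]] minb.
  by exists b; split=> // b' Lb' xb'; apply: minb; apply/asboolP; exists b'.
pose A := x `&` S a'.
have AL b : A b -> L b.
  move=> [xb Sb]; split; first by case: La' => Za' _; exact: Zclosed Sb.
  by move=> Gb; apply: nxG; exists b.
have patA : pat a' A.
  split=> [//|//|b Ab|b Ab]; last by apply: mina'; [exact: AL|case: Ab].
  by split; [case: Ab|exact: AL].
exists a' => //; split; first by apply/domG'; right.
(* On old coordinates both sides are false: the index is fresh there and [x] avoids [dom G]. *)
exists (code A, m a') => b C Sb [GC|[/= Lb ->]].
  split=> [Cn|xb]; first by case: (mP a' b C (code A) Sb GC).
  by case: nxG; exists b; split=> //; exists C.
rewrite cE//; split=> [[]//|xb]; by split.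
Qed.

(** * Basic neighbourhoods and compactness of the full cube *)

Definition cylinder (K : Type) (s : set K) (x : {ptws K -> bool}) :
  set {ptws K -> bool} := [set y | forall i, s i -> y i = x i].

Lemma sub_cylinder (K : Type) (s t : set K) (x : {ptws K -> bool}) :
  s `<=` t -> cylinder t x `<=` cylinder s x.
Proof. by move=> st y ty i /st /ty. Qed.

Lemma nbhs_cylinderP (K : choiceType) (x : {ptws K -> bool})
    (A : set {ptws K -> bool}) :
  nbhs x A <-> exists2 s, finite_set s & cylinder s x `<=` A.
Proof.
split=> [|[s /finite_fsetP[X ->] /filterS]]; last first.
  apply.
  have -> : cylinder [set` X] x =
      \bigcap_(i in [set` X]) [set y : {ptws K -> bool} | y i = x i] by [].
  apply: filter_bigI => i _.
  apply: (@proj_continuous K (fun=> bool) i x [set x i]).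
  exact: discrete_set1.
pose G := filter_from (@finite_set K) (fun s => cylinder s x).
have FG : Filter G.
  apply: filter_from_filter; first by exists set0; exact: finite_set0.
  move=> s t fs ft; exists (s `|` t); first by rewrite finite_setU.
  by move=> y sty; split; apply: sub_cylinder sty => i; [left|right].
(* Convergence in the product topology is coordinatewise, and [G] is eventually constant in each
   coordinate. *)
suff : G --> x by apply.
apply/cvg_sup => i; apply/cvg_image => //.
  apply/seteqP; split=> // b _; by exists (fun=> b).
move=> B /= /nbhs_singleton Bxi.
exists [set y | B (y i)].
  exists [set i]; first exact: finite_set1.
  by move=> y /= /(_ i erefl) ->.
apply/seteqP; split=> [_ [y /= By <-]//|b Bb].
by exists (fun=> b).
Qed.

Lemma cylinder_subcover (K : choiceType) (s : {ptws K -> bool} -> set K) :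
  (forall x, finite_set (s x)) ->
  exists2 D : set {ptws K -> bool}, finite_set D &
    forall y, exists2 x, D x & cylinder (s x) x y.
Proof.
move=> fs.
have : compact [set: {ptws K -> bool}].
  have -> : [set: {ptws K -> bool}] = [set f | forall i, [set: bool] (f i)].
    by apply/seteqP; split.
  apply: (@tychonoff K (fun=> bool) (fun=> setT)) => i; exact: bool_compact.
move=> /compact_near_coveringP cov.
(* Near-covering compactness is applied along the filter of ever larger sets of centres; its basis
   elements are indexed by finite sets, which yields a finite [D]. *)
pose F := filter_from (@finite_set {ptws K -> bool})
  (fun D => [set E | D `<=` E]).
have FF : Filter F.
  apply: filter_from_filter; first by exists set0; exact: finite_set0.
  move=> D E fD fE; exists (D `|` E); first by rewrite finite_setU.
  by move=> H; rewrite /= subUset.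
have [|D fD DP] := cov _ F (fun D y => exists2 x, D x & cylinder (s x) x y) FF.
  move=> x _; exists (cylinder (s x) x, [set D | D x]) => /=.
    split; first by apply/nbhs_cylinderP; exists (s x).
    by exists [set x] => [|D]; [exact: finite_set1|exact].
  by move=> [y D] [/= yx Dx]; exists x.
by exists D => // y; exact: DP.
Qed.

(** * Subspace topology of the punctured cube *)

Lemma nbhs_set_typeP (T : topologicalType) (A : set T) (x : A) (B : set A) :
  nbhs x B <-> exists2 C, nbhs (\val x) C & forall y : A, C (\val y) -> B y.
Proof.
split=> [[_ [[C oC <-] Cx CB]]|[C]].
  by exists C; first exact: open_nbhs_nbhs.
rewrite nbhsE => -[U [oU Ux] UC] CB; exists (set_val @^-1` U).
split=> [|//|y Uy]; first by exists U.
exact/CB/UC.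
Qed.

Lemma nbhs_punctured_cubeP (K : choiceType) (pt : bool)
    (x : punctured_cube K pt) (A : set (punctured_cube K pt)) :
  nbhs x A <-> exists2 s, finite_set s &
    forall y : punctured_cube K pt, cylinder s (\val x) (\val y) -> A y.
Proof.
split=> [/nbhs_set_typeP[C /nbhs_cylinderP[s fs sC] CA]|[s fs sA]].
  by exists s => // y /sC /CA.
apply/nbhs_set_typeP; exists (cylinder s (\val x)) => //.
by apply/nbhs_cylinderP; exists s.
Qed.

Lemma punctured_cubeP (K : choiceType) (pt : bool) (x : {ptws K -> bool}) :
  punctured_cube K pt x <-> exists i, x i <> pt.
Proof.
split=> [nx|[i xi] xpt]; last by apply: xi; rewrite xpt.
apply: contrapT => /forallNP xpt; apply: nx; apply/funext => i.
by apply: contrapT; exact: xpt.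
Qed.

Lemma punctured_cube_lift (K : choiceType) (pt : bool) (x : {ptws K -> bool}) i :
  x i <> pt -> exists y : punctured_cube K pt, \val y = x.
Proof.
move=> xi; have Px : x \in punctured_cube K pt.
  by apply/mem_set/punctured_cubeP; exists i.
by exists (SigSub Px).
Qed.

Lemma punctured_cube_neq (K : choiceType) (pt : bool) (x : punctured_cube K pt) :
  exists i, (\val x : {ptws K -> bool}) i <> pt.
Proof. by apply/punctured_cubeP; exact: set_valP. Qed.

Lemma punctured_cube_accessible (K : choiceType) (pt : bool) :
  accessible_space (punctured_cube K pt).
Proof.
move=> x y /eqP xy.
have [i xyi] : exists i,
    (\val x : {ptws K -> bool}) i <> (\val y : {ptws K -> bool}) i.
  apply: contrapT => /forallNP xyE; apply/xy/val_inj/funext => i.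
  by apply: contrapT; exact: xyE.
exists [set z | (\val z : {ptws K -> bool}) i = (\val x : {ptws K -> bool}) i].
split; last 2 first.
- exact: mem_set.
- by apply: mem_set => /esym.
rewrite openE => z zx; apply/nbhs_punctured_cubeP.
by exists [set i] => [|t /(_ i erefl) tz]; [exact: finite_set1|rewrite /= tz].
Qed.

(** * Closed discrete sets *)

Lemma locally_finite_closed_discrete (T : topologicalType) (D : set T) :
  accessible_space T ->
  (forall x : T, exists2 O, nbhs x O & finite_set (D `&` O)) -> closed_discrete D.
Proof.
move=> /accessible_finite_set_closed finclosed locfin.
(* Local finiteness passes to subsets, so all of them are closed; this gives closedness and
   discreteness of [D] at once. *)
have subclosed A : A `<=` D -> closed A.
  move=> AD; rewrite -openC openE => x nAx; have [V xV finDV] := locfin x.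
  have finAV : finite_set (A `&` V).
    by apply: sub_finite_set finDV => y [/AD].
  have xnAV : nbhs x (~` (A `&` V)).
    apply: open_nbhs_nbhs; split; last by case.
    by rewrite openC; exact: finclosed.
  by apply: filterS (filterI xnAV xV) => y [nAVy Vy] Ay; exact: nAVy.
split=> [|A]; first exact: subclosed.
exists (~` (set_val @` ~` A)).
  rewrite openC; apply: subclosed => _ [y _ <-]; exact: set_valP.
apply/seteqP; split=> [y /= nAy|y Ay [z nAz /val_inj zy]].
  by apply: contrapT => nA; apply: nAy; exists y.
by apply: nAz; rewrite zy.
Qed.

Lemma closed_discrete_isolated (T : topologicalType) (D : set T) (x : T) :
  closed_discrete D -> exists2 O, nbhs x O & forall y, O y -> D y -> y = x.
Proof.
move=> [cD dD]; have [Dx|nDx] := pselect (D x); last first.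
  by exists (~` D) => [|y]//; apply: open_nbhs_nbhs; split=> //; exact: closed_openC.
have [V oV VE] := dD [set SigSub (mem_set Dx)].
exists V.
  apply: open_nbhs_nbhs; split=> //.
  have : (set_val @^-1` V) (SigSub (mem_set Dx) : D) by rewrite VE.
  by [].
move=> y Vy Dy.
have : (set_val @^-1` V) (SigSub (mem_set Dy) : D) by [].
by rewrite VE => -[].
Qed.

Lemma closed_discrete_punctured_cubeP (K : choiceType) (pt : bool)
    (D : set (punctured_cube K pt)) :
  closed_discrete D <->
  forall i, finite_set (D `&` [set x | (\val x : {ptws K -> bool}) i <> pt]).
Proof.
split=> [cdD i|finD].
  (* The whole cube is covered, not only the part [x i <> pt]. Since [i] is always in [s], a [y]
     with [y i <> pt] lies only in cylinders whose centre also differs from [pt] at [i], and there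
     [y] in [D] must be the centre. *)
  have /choice[s sP] : forall x : {ptws K -> bool}, exists s : set K,
      [/\ finite_set s, s i & x i <> pt ->
       forall y, D y -> cylinder s x (\val y) -> \val y = x].
    move=> x; have [xi|xi] := pselect (x i = pt).
      by exists [set i]; split=> //; exact: finite_set1.
    have [x' x'E] := punctured_cube_lift xi.
    have [U /nbhs_punctured_cubeP[s fs sU] UD] := closed_discrete_isolated x' cdD.
    exists (s `|` [set i]); split=> //; last 2 first.
    - by right.
    - move=> _ y Dy yx; rewrite -x'E; congr val; apply: UD => //.
      by apply: sU; rewrite x'E; apply: sub_cylinder yx => j; left.
    - by rewrite finite_setU; split=> //; exact: finite_set1.
  have [|E finE covE] := @cylinder_subcover K s; first by move=> x; case: (sP x).
  have finvE : finite_set [set y : punctured_cube K pt | E (\val y)].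
    by apply: card_le_finite finE; apply: card_ge_preimage => y z _ _; exact: val_inj.
  apply: sub_finite_set finvE.
    move=> y [Dy yi]; have [x Ex xy] := covE (\val y).
    have [_ si xP] := sP x; rewrite /= (xP _ y Dy xy)//.
    by rewrite -(xy i si).
apply: locally_finite_closed_discrete; first exact: punctured_cube_accessible.
move=> x; have [i xi] := punctured_cube_neq x.
exists [set y | (\val y : {ptws K -> bool}) i <> pt]; last exact: finD.
apply/nbhs_punctured_cubeP; exists [set i]; first exact: finite_set1.
by move=> y /(_ i erefl) /= ->.
Qed.

(** * The four properties of the punctured cube *)

Lemma punctured_cube_tychonoff (R : realType) (K : choiceType) (pt : bool) :
  tychonoff_space (punctured_cube K pt).
Proof.
split; first exact: punctured_cube_accessible.
apply/(completely_regular_spaceP R) => x B cB nBx.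
have : nbhs x (~` B) by apply: open_nbhs_nbhs; split=> //; exact: closed_openC.
move=> /nbhs_punctured_cubeP[s fs sB].
(* Cylinders on finite sets are clopen, so this two-valued function is continuous. *)
pose f (y : punctured_cube K pt) : R :=
  (if `[< cylinder s (\val x) (\val y) >] then 0 else 1)%R.
exists f; split.
- move=> y A /nbhs_singleton Afy; apply/nbhs_punctured_cubeP; exists s => // z zy.
  rewrite /= /f.
  suff -> : cylinder s (\val x) (\val z) = cylinder s (\val x) (\val y) by [].
  by apply/propext; split=> h i si; rewrite -h// zy.
- by move=> _ [y _ <-]; rewrite /f; case: ifP; rewrite /= in_itv /= ?lexx ?ler01.
- by rewrite /f asboolT.
- by move=> y By; rewrite /f asboolF// => /sB.
Qed.

Lemma punctured_cube_discretely_star_Lindelof (K : choiceType) (pt : bool) :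
  discretely_star_Lindelof (punctured_cube K pt).
Proof.
move=> U [oU covU].
have /choice[S SP] : forall a : K, exists S : set K,
    [/\ finite_set S, S a & forall x : punctured_cube K pt,
     (\val x : {ptws K -> bool}) a <> pt -> exists V, [/\ U V, V x &
     forall y : punctured_cube K pt, cylinder S (\val x) (\val y) -> V y]].
  move=> a.
  have /choice[s sP] : forall x : {ptws K -> bool}, exists s : set K,
      [/\ finite_set s, s a & x a <> pt -> exists2 V, U V &
       forall y : punctured_cube K pt, cylinder s x (\val y) -> V y].
    move=> x; have [xa|xa] := pselect (x a = pt).
      by exists [set a]; split=> //; exact: finite_set1.
    have [x' x'E] := punctured_cube_lift xa.
    have [V UV Vx'] : (\bigcup_(V in U) V) x' by rewrite covU.
    have : nbhs x' V by apply: open_nbhs_nbhs; split=> //; exact: oU.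
    move=> /nbhs_punctured_cubeP[s fs sV].
    exists (s `|` [set a]); split.
    - by rewrite finite_setU; split=> //; exact: finite_set1.
    - by right.
    - move=> _; exists V => // y xy; apply: sV; rewrite x'E.
      by apply: sub_cylinder xy => i; left.
  have [|D finD covD] := @cylinder_subcover K s; first by move=> x; case: (sP x).
  exists ([set a] `|` \bigcup_(x in D) s x); split; last first.
  (* A [y] agreeing with [x] on [S] lies in the same cylinder of the finite subcover as [x], hence
     in the same [V]. *)
  - move=> x xa; have [z Dz zx] := covD (\val x).
    have [_ sa zP] := sP z.
    have [|V UV sV] := zP; first by rewrite -(zx a sa).
    exists V; split=> // [|y xy]; first exact: sV.
    apply: sV => i si; rewrite -(zx i si); apply: xy.
    by right; exists z.
  - by left.
  - rewrite finite_setU; split; first exact: finite_set1.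
    by apply: bigcup_finite => // x _; case: (sP x).
have [||c finc cP] := @finite_trace K S; try by move=> a; case: (SP a).
(* If no [c b] contains [n], then [f n] is the removed point and contributes nothing to [F]. *)
pose f n : {ptws K -> bool} := fun b => if `[< c b n >] then ~~ pt else pt.
have fE n b : f n b <> pt <-> c b n.
  rewrite /f; case: (pselect (c b n)) => cbn.
    by rewrite asboolT//; split=> // _; case: (pt).
  by rewrite asboolF//; split.
pose F := \bigcup_n [set x : punctured_cube K pt | \val x = f n].
have finF n : finite_set [set x : punctured_cube K pt | \val x = f n].
  apply: (card_le_finite _ (finite_set1 (f n))).
  exact: (card_ge_preimage (fun x y _ _ => @val_inj _ _ _ x y)).
exists F; split.
- by apply: bigcup_countable => // n _; exact: finite_set_countable.
- apply/closed_discrete_punctured_cubeP => a.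
  apply: sub_finite_set (bigcup_finite (finc a) (fun n _ => finF n)).
  by move=> x [[n _ xE] /= xa]; exists n => //; apply/fE; rewrite -xE.
- apply/seteqP; split=> // x _.
  have [|a xa [n nP]] := cP [set a | (\val x : {ptws K -> bool}) a <> pt].
    by have [a xa] := punctured_cube_neq x; exists a.
  have [_ Sa /(_ x xa)[V [UV Vx VS]]] := SP a.
  have fna : f n a <> pt by apply/fE/nP.
  have [z zE] := punctured_cube_lift fna.
  exists V => //; split=> //; exists z; split; last by exists n.
  apply: VS => b Sb; rewrite zE.
  have := nP b Sb; rewrite -fE /=.
  by case: (f n b); case: (\val x b); case: (pt); intuition congruence.
Qed.

Lemma punctured_cube_pseudocompact (R : realType) (K : choiceType) (pt : bool) :
  ~ countable [set: K] -> pseudocompact_space R (punctured_cube K pt).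
Proof.
move=> ncK f cf.
have cnf : continuous (fun x => `|f x|%R) by move=> x; exact: cvg_norm (cf x).
suff [M fM] : exists M : nat, forall x, (`|f x| <= M%:R)%R.
  exists M%:R%R; split; first exact: num_real.
  by move=> r Mr x _; apply: le_trans (fM x) (ltW Mr).
apply: contrapT => /forallNP unb.
have /choice[s sP] : forall n : nat, exists s : set K, finite_set s /\
    exists x : {ptws K -> bool}, forall y : punctured_cube K pt,
      cylinder s x (\val y) -> (n%:R < `|f y|)%R.
  move=> n; have /existsNP[x /negP] := unb n; rewrite -ltNge => nfx.
  have : nbhs x ((fun y => `|f y|%R) @^-1` [set r | n%:R < r]%R).
    apply: cnf; exact: open_nbhs_nbhs.
  by move=> /nbhs_punctured_cubeP[s fs sf]; exists s; split=> //; exists (\val x).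
have fs n : finite_set (s n) by case: (sP n).
pose A := \bigcup_n s n.
have cA : countable A.
  by apply: bigcup_countable => // n _; exact: finite_set_countable.
have [i0 Ai0] : exists i, ~ A i.
  apply: contrapT => /forallNP AT; apply: ncK; apply: sub_countable cA.
  by apply: subset_card_le => i _; apply: contrapT; exact: AT.
pose C := [set x : {ptws K -> bool} | forall i, ~ A i -> x i = ~~ pt].
have Cpt x : C x -> x i0 <> pt by move=> /(_ _ Ai0) ->; case: (pt).
(* Around a point of [C] the function is bounded by [t.2]; any other point has a cylinder missing
   [C], with dummy bound 0. *)
have /choice[t tP] : forall x : {ptws K -> bool}, exists t : set K * nat,
    [/\ finite_set t.1,
     C x -> forall y : punctured_cube K pt, cylinder t.1 x (\val y) ->
      (`|f y| <= t.2%:R)%R &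
     ~ C x -> forall y, C y -> ~ cylinder t.1 x y].
  move=> x; have [Cx|nCx] := pselect (C x); last first.
    have /existsNP[i /not_implyP[Ai xi]] := nCx.
    exists ([set i], 0); split=> //; first exact: finite_set1.
    by move=> _ y Cy /(_ i erefl); rewrite (Cy i Ai) => /esym.
  have [x' x'E] := punctured_cube_lift (Cpt _ Cx).
  have [n xn] : exists n : nat, (`|f x'| < n%:R)%R.
    exists (Num.truncn `|f x'|).+1; exact: truncnS_gt.
  have : nbhs x' ((fun y => `|f y|%R) @^-1` [set r | r < n%:R]%R).
    apply: cnf; exact: open_nbhs_nbhs.
  move=> /nbhs_punctured_cubeP[u fu uf].
  exists (u, n); split=> // _ y xy; apply/ltW/uf; by rewrite x'E.
have [|D /finite_fsetP[X DX] covD] := @cylinder_subcover K (fst \o t).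
  by move=> x; case: (tP x).
pose M := \max_(x <- X) (t x).2.
have [_ [x xP]] := sP M.
(* Changing [x] off [s M] keeps [f] above [M] in absolute value and moves the point into [C], where
   [M] bounds it. *)
pose y : {ptws K -> bool} := fun i => if `[< s M i >] then x i else ~~ pt.
have Cy : C y.
  by move=> i Ai; rewrite /y asboolF// => sMi; apply: Ai; exists M.
have [y' y'E] := punctured_cube_lift (Cpt _ Cy).
have : (M%:R < `|f y'|)%R.
  by apply: xP => i si; rewrite y'E /y asboolT.
apply/negP; rewrite -leNgt.
have [z Dz zy] := covD y.
have [_ Cz nCz] := tP z.
have {}Cz : C z by apply: contrapT => nz; exact: nCz zy.
apply: le_trans (_ : (t z).2%:R <= _)%R; last first.
  rewrite ler_nat; apply: (@leq_bigmax_seq _ _ xpredT (fun x => (t x).2)) => //.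
  by move: Dz; rewrite DX.
by have [_ + _] := tP z; apply; rewrite ?y'E.
Qed.

Lemma punctured_cube_extent (K : choiceType) (pt : bool) :
  infinite_set [set: K] -> has_extent (punctured_cube K pt) [set: K].
Proof.
move=> infK; split=> [D /closed_discrete_punctured_cubeP finD|J L DL].
  have /choice[g gP] := @punctured_cube_neq K pt.
  apply: (@card_le_countable_fibers _ _ _ g) => // k.
  apply: finite_set_countable; apply: sub_finite_set (finD k) => x [Dx <-].
  by split=> //; exact: gP.
pose e (a : K) : {ptws K -> bool} := fun b => if b == a then ~~ pt else pt.
have eE a b : e a b <> pt <-> b = a.
  rewrite /e; case: eqP => ba; split=> //; by case: (pt).
have /choice[e' e'E] : forall a, exists x : punctured_cube K pt, \val x = e a.
  by move=> a; apply: (@punctured_cube_lift _ _ _ a); apply/eE.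
have e'inj : injective e'.
  by move=> a b eab; apply/eE; rewrite -e'E -eab e'E; apply/eE.
apply: card_le_trans (DL (range e') _).
  have /card_eqPle[] : range e' #= [set: K].
    by apply: inj_card_eq => a b _ _; exact: e'inj.
  by [].
apply/closed_discrete_punctured_cubeP => a.
apply: sub_finite_set (finite_set1 (e' a)) => _ [[b _ <-]].
by rewrite /= e'E => /eE ->.
Qed.

Theorem mainTheorem3 (R : realType) (K : Type) (pt : bool) :
  ~ countable [set: K] ->
  let X : topologicalType := set_type (punctured_cube K pt) in
  [/\ tychonoff_space X,
      discretely_star_Lindelof X,
      pseudocompact_space R X
    & has_extent X [set: K]].
Proof.
elim/Pchoice: K => K ncK X; split.
- exact: (@punctured_cube_tychonoff R).
- exact: punctured_cube_discretely_star_Lindelof.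
- exact: punctured_cube_pseudocompact.
- by apply: punctured_cube_extent => /finite_set_countable.
Qed.
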